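(* Let $k$ be a field and let $A$ be a hereditary Artinian $k$-algebra which is splitting over its radical. Let $k(\Delta_A,\mathcal A)$ be the associated generalized path algebra of $A$, with ideal $J$ generated by all virtual $\mathcal A$-paths of length $1$, and let $\pi:k(\Delta_A,\mathcal A)\rightarrow A$ be a surjective $k$-algebra homomorphism with $J^s\subseteq\ker(\pi)\subseteq J$ for some positive integer $s$. If $\ker(\pi)\subseteq J^2$, then $\pi$ is an isomorphism.
   Context: Artinian means left Artinian; modules are left modules; hereditary means that submodules of projective (left) modules are projective. Let $r$ be the Jacobson radical of $A$. $A$ is splitting over its radical if there is a $k$-algebra homomorphism $\rho:A/r\to A$ with $p\circ\rho=\mathrm{Id}_{A/r}$, where $p:A\to A/r$ is the quotient map. Write $A/r=\bigoplus_{i\in\Delta_0}A_i$ with $A_i$ two-sided simple ideals (simple algebras). Natural quiver $\Delta_A$: vertex set $\Delta_0$; the number $t_{ij}$ of arrows from $i$ to $j$ is the minimal number of generators of $A_j\cdot(r/r^2)\cdot A_i$ as an $A_j$-$A_i$-bimodule ($0$ if this bimodule is zero). Associated generalized path algebra: let $\mathcal A=\{A_i : i\in\Delta_0\}$, $A_0=\prod_{i}A_i$, let $\Omega(i,j)$ be the set of arrows from $i$ to $j$ in $\Delta_A$, let $A_j\Omega(i,j)A_i$ be the free $A_j$-$A_i$-bimodule (free $A_j\otimes_kA_i^{op}$-module) with basis $\Omega(i,j)$, and $M=\bigoplus_{i,j}A_j\Omega(i,j)A_i$, an $A_0$-$A_0$-bimodule. Then $k(\Delta_A,\mathcal A)=T_{A_0}(M)=\bigoplus_{n\ge0}M^{\otimes_{A_0}n}$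 is the tensor algebra (with $M^{\otimes_{A_0}0}=A_0$), elements of $M^{\otimes_{A_0}n}$ are the virtual $\mathcal A$-paths of length $n$, and $J=\bigoplus_{n\ge1}M^{\otimes_{A_0}n}$. *)

(* Defs.v *)
From HB Require Import structures.
From mathcomp Require Import all_boot all_algebra.
From mathcomp Require Import finmap.
From mathcomp Require Import boolp classical_sets cardinality fsbigop.
From mathcomp Require Import freeg.

Set Implicit Arguments.
Unset Strict Implicit.
Unset Printing Implicit Defensive.

Import GRing.Theory.

Local Open Scope classical_set_scope.
Local Open Scope quotient_scope.
Local Open Scope ring_scope.

Definition surjective (X Y : Type) (f : X -> Y) : Prop :=
  forall y, exists x, f x = y.

Section Spans.
Variable V : zmodType.

Definition subgroup (W : set V) : Prop :=
  W 0 /\ forall x y, W x -> W y -> W (x - y).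

Definition gspan (G : set V) : set V :=
  [set x | forall W : set V, subgroup W -> G `<=` W -> W x].

Lemma subgroupN (W : set V) : subgroup W -> forall x, W x -> W (- x).
Proof. by move=> [W0 WB] x Wx; rewrite -sub0r; exact: WB. Qed.

Lemma subgroupD (W : set V) :
  subgroup W -> forall x y, W x -> W y -> W (x + y).
Proof.
move=> hW x y Wx Wy; rewrite -[y]opprK; apply: hW.2 => //; exact: subgroupN.
Qed.

Lemma sub_gspan (G : set V) : G `<=` gspan G.
Proof. by move=> x Gx W _ GW; exact: GW. Qed.

Lemma gspan_subgroup (G : set V) : subgroup (gspan G).
Proof.
split=> [W [] //|x y Gx Gy W hW GW].
by apply: hW.2; [exact: Gx | exact: Gy].
Qed.

Lemma gspan_min (G W : set V) : subgroup W -> G `<=` W -> gspan G `<=` W.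
Proof. by move=> hW GW x Gx; exact: Gx. Qed.

Definition gspan_pred (G : set V) : {pred V} := fun x => `[< gspan G x >].

Fact gspan_zmod_closed G : zmod_closed (gspan_pred G).
Proof.
have [G0 GB] := gspan_subgroup G.
split; first by apply/asboolP.
by move=> x y /asboolP Gx /asboolP Gy; apply/asboolP; exact: GB.
Qed.

HB.instance Definition _ G :=
  GRing.isZmodClosed.Build V (gspan_pred G) (gspan_zmod_closed G).

End Spans.

Section Rings.
Variable R : nzRingType.

Definition left_ideal (L : set R) : Prop :=
  subgroup L /\ forall a x, L x -> L (a * x).

Definition maximal_left_ideal (L : set R) : Prop :=
  [/\ left_ideal L, ~ L 1 &
      forall K : set R, left_ideal K -> L `<=` K -> ~ K 1 -> K = L].

Record ideal := Ideal {
  ideal_set : set R;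
  ideal_subgroup : subgroup ideal_set;
  ideal_mull : forall a x, ideal_set x -> ideal_set (a * x);
  ideal_mulr : forall a x, ideal_set x -> ideal_set (x * a) }.

Definition ideal_pred (I : ideal) : {pred R} := fun x => `[< ideal_set I x >].

Fact ideal_zmod_closed I : zmod_closed (ideal_pred I).
Proof.
have [I0 IB] := ideal_subgroup I.
split; first by apply/asboolP.
by move=> x y /asboolP Ix /asboolP Iy; apply/asboolP; exact: IB.
Qed.

HB.instance Definition _ I :=
  GRing.isZmodClosed.Build R (ideal_pred I) (ideal_zmod_closed I).

Record ideal_type (I : ideal) :=
  IdealElt { ideal_val :> R; _ : ideal_val \in ideal_pred I }.
HB.instance Definition _ I := [isSub for @ideal_val I].
HB.instance Definition _ I := [Choice of ideal_type I by <:].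
HB.instance Definition _ I := [SubChoice_isSubZmodule of ideal_type I by <:].

Section IdealElements.
Variable I : ideal.

Fact ideal_valP (x : ideal_type I) : ideal_set I (ideal_val x).
Proof. by case: x => x Ix; exact: (asboolW Ix). Qed.

Definition ielt x (Ix : ideal_set I x) : ideal_type I :=
  @IdealElt I x (asboolT Ix).

Definition ilmul (a : R) (x : ideal_type I) : ideal_type I :=
  ielt (ideal_mull a (ideal_valP x)).

Definition irmul (x : ideal_type I) (a : R) : ideal_type I :=
  ielt (ideal_mulr a (ideal_valP x)).

Lemma ideal_valD (x y : ideal_type I) :
  ideal_val (x + y) = ideal_val x + ideal_val y.
Proof. by []. Qed.

Lemma ideal_valB (x y : ideal_type I) :
  ideal_val (x - y) = ideal_val x - ideal_val y.
Proof. by []. Qed.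

Lemma ilmulDr a : {morph ilmul a : x y / x + y}.
Proof. by move=> x y; apply: val_inj; exact: mulrDr. Qed.
Lemma ilmulDl x : {morph ilmul^~ x : a b / a + b}.
Proof. by move=> a b; apply: val_inj; rewrite /= mulrDl. Qed.
Lemma ilmulA a b x : ilmul a (ilmul b x) = ilmul (a * b) x.
Proof. by apply: val_inj; rewrite /= mulrA. Qed.
Lemma ilmul1 x : ilmul 1 x = x.
Proof. by apply: val_inj; rewrite /= mul1r. Qed.
Lemma irmulDl a : {morph irmul^~ a : x y / x + y}.
Proof. by move=> x y; apply: val_inj; exact: mulrDl. Qed.
Lemma irmulDr x : {morph irmul x : a b / a + b}.
Proof. by move=> a b; apply: val_inj; rewrite /= mulrDr. Qed.
Lemma irmulA a b x : irmul (irmul x a) b = irmul x (a * b).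
Proof. by apply: val_inj; rewrite /= mulrA. Qed.
Lemma irmul1 x : irmul x 1 = x.
Proof. by apply: val_inj; rewrite /= mulr1. Qed.
Lemma ilrmul a b x : irmul (ilmul a x) b = ilmul a (irmul x b).
Proof. by apply: val_inj; rewrite /= mulrA. Qed.

End IdealElements.

Definition ideal_gen (X : set R) : set R :=
  [set x | forall K : ideal, X `<=` ideal_set K -> ideal_set K x].

Definition mulset (X Y : set R) : set R :=
  gspan [set z | exists x y, [/\ X x, Y y & z = x * y]].

Definition powset (X : set R) (n : nat) : set R :=
  if n is m.+1 then iter m (mulset X) X else [set: R].

(* I is nonzero and, as an algebra, has no ideals but 0 and itself. *)
Definition simple_ideal (I : ideal) : Prop :=
  (exists x, ideal_set I x /\ x != 0) /\
  forall W : set R, subgroup W -> W `<=` ideal_set I ->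
    (forall a w, ideal_set I a -> W w -> W (a * w) /\ W (w * a)) ->
    W `<=` [set 0] \/ ideal_set I `<=` W.

Definition internal_direct_sum (D : finType) (I_ : D -> ideal) : Prop :=
  forall x : R, exists! a : (forall i, ideal_type (I_ i)),
    x = \sum_i ideal_val (a i).

Definition left_artinian : Prop :=
  forall L : nat -> set R, (forall n, left_ideal (L n)) ->
    (forall n, L n.+1 `<=` L n) -> exists N, forall n, (N <= n)%N -> L n = L N.

Definition projective (P : lmodType R) : Prop :=
  forall (X Y : lmodType R) (f : {linear X -> Y}) (g : {linear P -> Y}),
    surjective f -> exists h : {linear P -> X}, forall x, f (h x) = g x.

(* A submodule N of P is given through an injective linear map N -> P. *)
Definition hereditary : Prop :=
  forall (P N : lmodType R) (i : {linear N -> P}),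
    injective i -> projective P -> projective N.

Definition radical : set R :=
  [set x | forall L : set R, maximal_left_ideal L -> L x].

Fact radical_subgroup : subgroup radical.
Proof.
split=> [L [] [] []//|x y rx ry L mL].
by case: (mL) => -[[_ LB] _] _ _; apply: LB; [exact: (rx L mL) | exact: (ry L mL)].
Qed.

Fact radical_mull a x : radical x -> radical (a * x).
Proof. by move=> rx L mL; case: (mL) => -[_ LM] _ _; apply: LM; exact: (rx L mL). Qed.

Fact radical_mulr a x : radical x -> radical (x * a).
Proof.
move=> rx L mL; case: (mL) => -[[L0 LB] LM] L1 Lmax.
have [La|nLa] := pselect (L a); first exact: LM.
suff mL' : maximal_left_ideal [set y | L (y * a)] by exact: (rx _ mL').
split.
- split=> [|b y /= Ly]; last by rewrite -mulrA; exact: LM.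
  split=> [|y z /= Ly Lz]; first by rewrite /= mul0r.
  by rewrite mulrBl; exact: LB.
- by rewrite /= mul1r.
move=> K [[K0 KB] KM] LK K1; apply/seteqP; split=> // y Ky /=.
apply: contrapT => nLy; apply: K1.
pose Q : set R := [set z | exists b l, L l /\ z = b * (y * a) + l].
have hQ : left_ideal Q.
  split; first split.
  - by exists 0, 0; rewrite mul0r addr0.
  - move=> _ _ [b [l [Ll ->]]] [c [m [Lm ->]]]; exists (b - c), (l - m).
    by split; [exact: LB | rewrite mulrBl opprD addrACA].
  - move=> c _ [b [l [Ll ->]]]; exists (c * b), (c * l).
    by split; [exact: LM | rewrite mulrDr !mulrA].
have Qya : Q (y * a) by exists 1, 0; rewrite mul1r addr0.
have LQ : L `<=` Q by move=> l Ll; exists 0, l; rewrite mul0r add0r.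
have [Q1|nQ1] := pselect (Q 1); last first.
  by exfalso; apply: nLy; rewrite -(Lmax Q hQ LQ nQ1).
have [b [l [Ll E]]] : Q a by rewrite -[a]mulr1; exact: hQ.2.
have : K (1 - b * y).
  apply: LK => /=; rewrite mulrBl mul1r -mulrA {1}E.
  by rewrite addrAC subrr add0r.
move=> K1b; rewrite -[1](subrK (b * y)).
by apply: (subgroupD (conj K0 KB)) => //; exact: KM.
Qed.

Definition rad : ideal := Ideal radical_subgroup radical_mull radical_mulr.

Lemma exists_maximal_left_ideal : exists L : set R, maximal_left_ideal L.
Proof.
pose P (X : set R) := X = set0 \/ (left_ideal X /\ ~ X 1).
have [F FP Ftot|L [PL Lmax]] := @Zorn_bigcup R P.
  have [[X [FX X0]]|nF] := pselect (exists X, F X /\ X <> set0); last first.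
    left; apply/seteqP; split=> // x [X FX Xx]; apply: nF.
    by exists X; split=> // X0; rewrite X0 in Xx.
  have FL Y y : F Y -> Y y -> left_ideal Y /\ ~ Y 1.
    by move=> FY Yy; case: (FP _ FY) => // Y0; rewrite Y0 in Yy.
  have [x Xx] : exists x, X x.
    apply: contrapT => nX; apply: X0; apply/seteqP; split=> // x Xx.
    by apply: nX; exists x.
  right; split; last by move=> [Y FY Y1]; have [_ /(_ Y1)] := FL _ _ FY Y1.
  split; first split.
  - by exists X => //; have [[[]]] := FL _ _ FX Xx.
  - move=> y z [Y FY Yy] [Z FZ Zz].
    have [YZ|ZY] := Ftot _ _ FY FZ.
    + exists Z => //; have [[[_ ZB] _] _] := FL _ _ FZ Zz.
      by apply: ZB => //; exact: YZ.
    + exists Y => //; have [[[_ YB] _] _] := FL _ _ FY Yy.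
      by apply: YB => //; exact: ZY.
  - by move=> a y [Y FY Yy]; exists Y => //; have [[_ YM] _] := FL _ _ FY Yy;
      exact: YM.
case: PL => [L0|[hL L1]].
  exfalso; apply: (Lmax [set 0]).
    by rewrite L0; split=> // /(_ 0 (erefl _)).
  right; split; last by move=> /= /eqP; rewrite oner_eq0.
  split; first by split=> // x y -> ->; rewrite /= subr0.
  by move=> a x /= ->; rewrite mulr0.
exists L; split=> // K hK LK K1; apply: contrapT => nKL.
apply: (Lmax K); last by right.
by split=> // KL; apply: nKL; apply/seteqP.
Qed.

Lemma rad_proper : ~ ideal_set rad 1.
Proof.
have [L mL] := exists_maximal_left_ideal.
by move=> /(_ L mL); case: (mL).
Qed.

End Rings.

Section ZmodQuotients.
Variables (V : zmodType) (W : zmodClosed V).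

Definition zquot : Type := Quotient.quot W.
HB.instance Definition _ := GRing.Zmodule.copy zquot (Quotient.quot W).

Definition zq (x : V) : zquot := \pi_(Quotient.quot W) x.
Definition zrep (x : zquot) : V := repr (x : Quotient.quot W).

Lemma zrepK : cancel zrep zq.
Proof. by move=> x; rewrite /zq /zrep reprK. Qed.

Lemma zqP x y : reflect (zq x = zq y) (x - y \in W).
Proof. by rewrite Quotient.idealrBE; apply: eqP. Qed.

Fact zq_is_zmod_morphism : zmod_morphism zq.
Proof. by move=> x y; rewrite /zq !piE. Qed.

HB.instance Definition _ :=
  GRing.isZmodMorphism.Build V zquot zq zq_is_zmod_morphism.

Lemma zrepB x : zrep (zq x) - x \in W.
Proof. by apply/zqP; rewrite zrepK. Qed.

End ZmodQuotients.

Section QuotientAlgebra.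
Variables (k : fieldType) (A : algType k) (I : ideal A).
Hypothesis I1 : ~ ideal_set I 1.

Definition quotalg of ~ ideal_set I 1 : Type := zquot (ideal_pred I).
Local Notation Q := (quotalg I1).
HB.instance Definition _ := GRing.Zmodule.copy Q (zquot (ideal_pred I)).

Definition qproj (x : A) : Q := zq (ideal_pred I) x.
Definition qrep (x : Q) : A := zrep x.

Definition qmul (x y : Q) : Q := qproj (qrep x * qrep y).
Definition qscale (c : k) (x : Q) : Q := qproj (c *: qrep x).

Lemma qrepK : cancel qrep qproj. Proof. exact: zrepK. Qed.

Lemma qprojP x y : qproj x = qproj y <-> ideal_set I (x - y).
Proof.
split=> [/zqP/asboolP //|Ixy]; apply/zqP; exact/asboolP.
Qed.

Lemma qrepB x : ideal_set I (qrep (qproj x) - x).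
Proof. by apply/qprojP; rewrite qrepK. Qed.

Fact qproj_is_zmod_morphism : zmod_morphism qproj.
Proof. exact: zq_is_zmod_morphism. Qed.

HB.instance Definition _ :=
  GRing.isZmodMorphism.Build A Q qproj qproj_is_zmod_morphism.

Fact qprojM x y : qproj (x * y) = qmul (qproj x) (qproj y).
Proof.
apply/esym/qprojP; set x' := qrep _; set y' := qrep _.
have -> : x' * y' - x * y = (x' - x) * y' + x * (y' - y).
  by rewrite mulrBl mulrBr addrA subrK.
apply: (subgroupD (ideal_subgroup I)).
  exact/ideal_mulr/qrepB.
exact/ideal_mull/qrepB.
Qed.

Fact qprojZ c x : qproj (c *: x) = qscale c (qproj x).
Proof.
apply/esym/qprojP; rewrite -scalerBr -[_ - x]mul1r scalerAl.
exact/ideal_mull/qrepB.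
Qed.

Fact qmulA : associative qmul.
Proof.
move=> x y z; rewrite -[x]qrepK -[y]qrepK -[z]qrepK.
by rewrite -!qprojM mulrA.
Qed.

Fact qmul1 : left_id (qproj 1) qmul.
Proof. by move=> x; rewrite -[x]qrepK -qprojM mul1r. Qed.

Fact qmulr1 : right_id (qproj 1) qmul.
Proof. by move=> x; rewrite -[x]qrepK -qprojM mulr1. Qed.

Fact qmulDl : left_distributive qmul +%R.
Proof.
move=> x y z; rewrite -[x]qrepK -[y]qrepK -[z]qrepK.
by rewrite -raddfD -!qprojM mulrDl raddfD.
Qed.

Fact qmulDr : right_distributive qmul +%R.
Proof.
move=> x y z; rewrite -[x]qrepK -[y]qrepK -[z]qrepK.
by rewrite -raddfD -!qprojM mulrDr raddfD.
Qed.

Fact q1_neq0 : qproj 1 != 0.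
Proof.
by apply/eqP; rewrite -[0](raddf0 qproj) => /qprojP; rewrite subr0.
Qed.

HB.instance Definition _ := GRing.Zmodule_isNzRing.Build Q
  qmulA qmul1 qmulr1 qmulDl qmulDr q1_neq0.

Fact qscaleA a b x : qscale a (qscale b x) = qscale (a * b) x.
Proof. by rewrite -[x]qrepK -!qprojZ scalerA. Qed.

Fact qscale1 : left_id 1 qscale.
Proof. by move=> x; rewrite -[x]qrepK -qprojZ scale1r. Qed.

Fact qscaleDr : right_distributive qscale +%R.
Proof.
move=> a x y; rewrite -[x]qrepK -[y]qrepK.
by rewrite -raddfD -!qprojZ scalerDr raddfD.
Qed.

Fact qscaleDl x : {morph qscale^~ x : a b / a + b}.
Proof. by move=> a b; rewrite -[x]qrepK -!qprojZ scalerDl raddfD. Qed.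

HB.instance Definition _ := GRing.Zmodule_isLmodule.Build k Q
  qscaleA qscale1 qscaleDr qscaleDl.

Fact qscaleAl (a : k) (x y : Q) : a *: (x * y) = (a *: x) * y.
Proof.
change (qscale a (qmul x y) = qmul (qscale a x) y).
rewrite -[x]qrepK -[y]qrepK.
by rewrite -qprojZ -!qprojM -qprojZ scalerAl.
Qed.

Fact qscaleAr (a : k) (x y : Q) : a *: (x * y) = x * (a *: y).
Proof.
change (qscale a (qmul x y) = qmul x (qscale a y)).
rewrite -[x]qrepK -[y]qrepK.
by rewrite -qprojZ -!qprojM -qprojZ scalerAr.
Qed.

HB.instance Definition _ := GRing.Lmodule_isLalgebra.Build k Q qscaleAl.
HB.instance Definition _ := GRing.Lalgebra_isAlgebra.Build k Q qscaleAr.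

Fact qproj_is_monoid_morphism : monoid_morphism qproj.
Proof. by split=> // x y; rewrite qprojM. Qed.

HB.instance Definition _ :=
  GRing.isMonoidMorphism.Build A Q qproj qproj_is_monoid_morphism.

Fact qproj_is_scalable : scalable qproj.
Proof. exact: qprojZ. Qed.

HB.instance Definition _ :=
  GRing.isScalable.Build k A Q *:%R qproj qproj_is_scalable.

End QuotientAlgebra.

Section Subgroups.
Variables (V : zmodType).

Lemma subgroup_sum (W : set V) (J : Type) (r : seq J) (F : J -> V) :
  subgroup W -> (forall j, W (F j)) -> W (\sum_(j <- r) F j).
Proof.
move=> hW WF; elim: r => [|j r IHr]; first by rewrite big_nil; case: hW.
by rewrite big_cons; exact: (subgroupD hW).
Qed.

Lemma subgroup_mulz (W : set V) x (m : int) : subgroup W -> W x -> W (x *~ m).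
Proof.
move=> hW Wx; have Wn n : W (x *+ n).
  elim: n => [|n IHn]; first by rewrite mulr0n; case: hW.
  by rewrite mulrS; exact: (subgroupD hW).
case: m => n; first exact: Wn.
by rewrite NegzE mulrNz; apply: (subgroupN hW); exact: (Wn n.+1).
Qed.

End Subgroups.

Section ZmodMorphisms.
Variables (U V : zmodType) (f : U -> V).
Hypothesis fB : zmod_morphism f.

Lemma zmodmor0 : f 0 = 0.
Proof. by rewrite -[0 in LHS](subrr 0) fB subrr. Qed.

Lemma zmodmorD : {morph f : x y / x + y}.
Proof.
move=> x y; have fN z : f (- z) = - f z.
  by rewrite -[- z]sub0r fB zmodmor0 sub0r.
by rewrite -{1}[y]opprK fB fN opprK.
Qed.

End ZmodMorphisms.

Lemma zmod_morphismI (U V : zmodType) (f : U -> V) :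
  {morph f : x y / x + y} -> zmod_morphism f.
Proof. by move=> fD x y; apply/eqP; rewrite eq_sym subr_eq -fD subrK. Qed.


(* The tensor product of X and Y over R, where R acts on the right of X and *)
(* on the left of Y: the free abelian group on X * Y modulo the relations.   *)
Section Tensor.
Variables (R : Type) (X Y : zmodType) (ra : X -> R -> X) (la : R -> Y -> Y).

Inductive tensor_rel : set {freeg (X * Y)} :=
| TensorDl x x' y :
    tensor_rel (<< (x + x', y) >> - << (x, y) >> - << (x', y) >>)
| TensorDr x y y' :
    tensor_rel (<< (x, y + y') >> - << (x, y) >> - << (x, y') >>)
| TensorM x r y : tensor_rel (<< (ra x r, y) >> - << (x, la r y) >>).

Definition tensor : Type := zquot (gspan_pred tensor_rel).
HB.instance Definition _ :=
  GRing.Zmodule.copy tensor (zquot (gspan_pred tensor_rel)).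

Definition tpure (x : X) (y : Y) : tensor :=
  zq (gspan_pred tensor_rel) << (x, y) >>.

Definition tlift (G : zmodType) (b : X -> Y -> G) (z : tensor) : G :=
  fglift (fun p : X * Y => b p.1 p.2 : zmodule G) (zrep z).

Lemma tpureDl x x' y : tpure (x + x') y = tpure x y + tpure x' y.
Proof.
rewrite /tpure -raddfD; apply/zqP/asboolP.
by apply: sub_gspan; rewrite opprD addrA; exact: TensorDl.
Qed.

Lemma tpureDr x y y' : tpure x (y + y') = tpure x y + tpure x y'.
Proof.
rewrite /tpure -raddfD; apply/zqP/asboolP.
by apply: sub_gspan; rewrite opprD addrA; exact: TensorDr.
Qed.

Lemma tpureM x r y : tpure (ra x r) y = tpure x (la r y).
Proof.
by rewrite /tpure; apply/zqP/asboolP; apply: sub_gspan; exact: TensorM.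
Qed.

Lemma tensor_ind (P : tensor -> Prop) :
  P 0 -> (forall u v, P u -> P v -> P (u - v)) ->
  (forall x y, P (tpure x y)) -> forall z, P z.
Proof.
move=> P0 PB Pp z; pose W : set tensor := [set z | P z].
have hW : subgroup W by split.
rewrite -[z]zrepK -[zrep z]freeg_sumE raddf_sum /=.
apply: (@subgroup_sum _ W) => // -[x y].
have -> : << coeff (x, y) (zrep z) *g (x, y) >>
    = << (x, y) >> *~ coeff (x, y) (zrep z) :> {freeg (X * Y)}.
  by rewrite freegU_mulz intz.
by rewrite raddfMz; apply: subgroup_mulz => //; exact: Pp.
Qed.

Section Lift.
Variables (G : zmodType) (b : X -> Y -> G).
Hypothesis bDl : forall x x' y, b (x + x') y = b x y + b x' y.
Hypothesis bDr : forall x y y', b x (y + y') = b x y + b x y'.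
Hypothesis bM : forall x r y, b (ra x r) y = b x (la r y).

Let F (D : {freeg (X * Y)}) : G := fglift (fun p : X * Y => b p.1 p.2 : zmodule G) D.

Let FB : zmod_morphism F.
Proof. by move=> D1 D2; rewrite /F lift_is_additive. Qed.

Let FU p : F << p >> = b p.1 p.2.
Proof. by rewrite /F liftU scale1r. Qed.

Let F_rel D : gspan_pred tensor_rel D -> F D = 0.
Proof.
move=> /asboolP; apply: (gspan_min (W := [set D | F D = 0])).
  have F0 : F 0 = 0 by rewrite -[0 in LHS](subrr 0) FB subrr.
  by split=> //= D1 D2 E1 E2; rewrite FB E1 E2 subrr.
move=> _ [x x' y|x y y'|x r y] /=; rewrite !FB !FU /=.
- by rewrite bDl -addrA -opprD subrr.
- by rewrite bDr -addrA -opprD subrr.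
- by rewrite bM subrr.
Qed.

Lemma tlift_pure x y : tlift b (tpure x y) = b x y.
Proof.
apply/subr0_eq; rewrite -[b x y]/(b (x, y).1 (x, y).2) -FU -FB.
by apply: F_rel; exact: zrepB.
Qed.

Lemma tliftB : zmod_morphism (tlift b).
Proof.
move=> u v; apply/subr0_eq; rewrite -!FB.
apply: F_rel; apply/zqP; rewrite zrepK raddfB.
by rewrite /= !zrepK.
Qed.

End Lift.

Lemma eq_tensor (G : zmodType) (f g : tensor -> G) :
  zmod_morphism f -> zmod_morphism g ->
  (forall x y, f (tpure x y) = g (tpure x y)) -> f =1 g.
Proof.
move=> fB gB fg; apply: tensor_ind => [|u v fgu fgv|//].
  by rewrite -(subrr 0) fB gB !subrr.
by rewrite fB gB fgu fgv.
Qed.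

Definition tmap (f : X -> X) (g : Y -> Y) : tensor -> tensor :=
  tlift (fun x y => tpure (f x) (g y)).

Section Map.
Variables (f : X -> X) (g : Y -> Y).
Hypothesis fD : {morph f : x y / x + y}.
Hypothesis gD : {morph g : x y / x + y}.
Hypothesis fM : forall x r, f (ra x r) = ra (f x) r.
Hypothesis gM : forall r y, g (la r y) = la r (g y).

Let bDl x x' y : tpure (f (x + x')) (g y) = tpure (f x) (g y) + tpure (f x') (g y).
Proof. by rewrite fD tpureDl. Qed.
Let bDr x y y' : tpure (f x) (g (y + y')) = tpure (f x) (g y) + tpure (f x) (g y').
Proof. by rewrite gD tpureDr. Qed.
Let bM x r y : tpure (f (ra x r)) (g y) = tpure (f x) (g (la r y)).
Proof. by rewrite fM tpureM gM. Qed.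

Lemma tmap_pure x y : tmap f g (tpure x y) = tpure (f x) (g y).
Proof. exact: tlift_pure. Qed.

Lemma tmapB : zmod_morphism (tmap f g).
Proof. exact: tliftB. Qed.

Lemma tmapD : {morph tmap f g : u v / u + v}.
Proof.
exact: zmodmorD tmapB.
Qed.

End Map.
End Tensor.

Section DirectSum.
Variables (I : choiceType) (V : I -> zmodType).

Record dsum := Dsum {
  dcoef :> forall i, V i;
  dcoefP : finite_set [set i | dcoef i <> 0] }.

HB.instance Definition _ := gen_eqMixin dsum.
HB.instance Definition _ := gen_choiceMixin dsum.

Lemma dsum_eq (x y : dsum) : (forall i, x i = y i) -> x = y.
Proof.
case: x y => [f fP] [g gP] /= fg.
have E : f = g by exact: functional_extensionality_dep.
by subst g; congr Dsum; exact: Prop_irrelevance.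
Qed.

Fact dzeroP : finite_set [set i | (0 : V i) <> 0].
Proof. by apply: (sub_finite_set _ (finite_set0 I)) => i /= /(_ erefl). Qed.

Fact daddP (x y : dsum) : finite_set [set i | x i + y i <> 0].
Proof.
have fxy : finite_set ([set i | x i <> 0] `|` [set i | y i <> 0]).
  by rewrite finite_setU; split; exact: dcoefP.
apply: (sub_finite_set _ fxy) => i /=; have [->|/eqP nx _] := eqVneq (x i) 0.
  by rewrite add0r; right.
by left.
Qed.

Fact doppP (x : dsum) : finite_set [set i | - x i <> 0].
Proof.
apply: (sub_finite_set _ (dcoefP x)) => i /= nx x0.
by apply: nx; rewrite x0 oppr0.
Qed.

Definition dzero := Dsum dzeroP.
Definition dadd x y := Dsum (daddP x y).
Definition dopp x := Dsum (doppP x).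

Fact daddA : associative dadd.
Proof. by move=> x y z; apply: dsum_eq => i; exact: addrA. Qed.
Fact daddC : commutative dadd.
Proof. by move=> x y; apply: dsum_eq => i; exact: addrC. Qed.
Fact dadd0 : left_id dzero dadd.
Proof. by move=> x; apply: dsum_eq => i; exact: add0r. Qed.
Fact daddN : left_inverse dzero dopp dadd.
Proof. by move=> x; apply: dsum_eq => i; exact: addNr. Qed.

HB.instance Definition _ :=
  GRing.isZmodule.Build dsum daddA daddC dadd0 daddN.

Lemma dcoefB (x y : dsum) i : (x - y) i = x i - y i. Proof. by []. Qed.
Lemma dcoef0 i : (0 : dsum) i = 0. Proof. by []. Qed.

Fact dinjP i (v : V i) :
  finite_set [set j | dfwith (fun j => 0 : V j) v j <> 0].
Proof.
apply: (sub_finite_set _ (finite_set1 i)) => j /=.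
by case: dfwithP => // l il /(_ erefl).
Qed.

Definition dinj i (v : V i) : dsum := Dsum (dinjP v).

Lemma dinj_in i (v : V i) : dinj v i = v.
Proof. by rewrite /= dfwith_in. Qed.

Lemma dinj_out i j (v : V i) : i != j -> dinj v j = 0.
Proof. by move=> ij; rewrite /= dfwith_out. Qed.

Fact dinj_is_zmod_morphism i : zmod_morphism (@dinj i).
Proof.
move=> u v; apply: dsum_eq => j; rewrite dcoefB.
have [<-|ij] := eqVneq i j; first by rewrite !dinj_in.
by rewrite !dinj_out // subr0.
Qed.

HB.instance Definition _ i :=
  GRing.isZmodMorphism.Build (V i) dsum (@dinj i) (@dinj_is_zmod_morphism i).

Definition dlift (G : zmodType) (f : forall i, V i -> G) (x : dsum) : G :=
  \sum_(i \in [set: I]) f i (x i).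

Definition dsupp (x : dsum) : seq I := fset_set [set i | x i <> 0].

Lemma dsuppP (x : dsum) i : reflect (x i <> 0) (i \in dsupp x).
Proof.
rewrite /dsupp in_fset_set ?inE; last exact: dcoefP.
exact: asboolP.
Qed.

Lemma dsum_sum (x : dsum) : x = \sum_(i <- dsupp x) dinj (x i).
Proof.
apply: dsum_eq => j.
have -> : (\sum_(i <- dsupp x) dinj (x i)) j
    = \sum_(i <- dsupp x) (dinj (x i) j).
  by elim: (dsupp x) => [|i r IHr]; rewrite ?big_nil ?big_cons //= -IHr.
have [jx|jx] := boolP (j \in dsupp x).
  rewrite (bigD1_seq j) //=; last exact: fset_uniq.
  rewrite dfwith_in big1 ?addr0 // => i ij.
  by rewrite dfwith_out.
rewrite big1_seq => [|i /andP[_ ix]].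
  by apply: contrapT => /dsuppP; apply/negP.
by rewrite dinj_out //; apply: contraNneq jx => <-.
Qed.

Lemma dsum_ind (P : dsum -> Prop) :
  P 0 -> (forall x y, P x -> P y -> P (x - y)) ->
  (forall i (v : V i), P (dinj v)) -> forall x, P x.
Proof.
move=> P0 PB Pi x; rewrite [x]dsum_sum.
have hP : subgroup (P : set dsum) by split.
by apply: (subgroup_sum _ hP) => i; exact: Pi.
Qed.

Section Lift.
Variables (G : zmodType) (f : forall i, V i -> G).
Hypothesis fB : forall i, zmod_morphism (@f i).

Lemma dliftE (A : {fset I}) (x : dsum) :
  (forall i, i \notin A -> x i = 0) -> dlift f x = \sum_(i <- A) f (x i).
Proof.
by move=> xA; apply: fsbigTE => i /xA ->; exact: zmodmor0.
Qed.

Lemma dliftB : zmod_morphism (dlift f).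
Proof.
move=> x y; pose A := fset_set ([set i | x i <> 0] `|` [set i | y i <> 0]).
have fxy : finite_set ([set i | x i <> 0] `|` [set i | y i <> 0]).
  by rewrite finite_setU; split; exact: dcoefP.
have Ax i : i \notin A -> x i = 0.
  rewrite in_fset_set // => /negP; rewrite inE => nA.
  by apply: contrapT => xi; apply: nA; left.
have Ay i : i \notin A -> y i = 0.
  rewrite in_fset_set // => /negP; rewrite inE => nA.
  by apply: contrapT => yi; apply: nA; right.
rewrite !(@dliftE A) // => [|i iA]; last by rewrite dcoefB Ax ?Ay ?subr0.
by rewrite -sumrB; apply: eq_bigr => i _; rewrite dcoefB fB.
Qed.

Lemma dlift_inj i (v : V i) : dlift f (dinj v) = f v.
Proof.
rewrite (@dliftE (fset_set [set i])) => [|j].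
  by rewrite fset_set1 big_seq_fset1 dinj_in.
by rewrite fset_set1 inE eq_sym => /dinj_out ->.
Qed.

End Lift.

Lemma eq_dsum (G : zmodType) (f g : dsum -> G) :
  zmod_morphism f -> zmod_morphism g ->
  (forall i (v : V i), f (dinj v) = g (dinj v)) -> f =1 g.
Proof.
move=> fB gB fg; apply: dsum_ind => [|x y fgx fgy|//].
  by rewrite !zmodmor0.
by rewrite fB gB fgx fgy.
Qed.

Definition dmap (f : forall i, V i -> V i) : dsum -> dsum :=
  dlift (fun i v => dinj (f i v)).

Section Map.
Variable f : forall i, V i -> V i.
Hypothesis fB : forall i, zmod_morphism (@f i).

Lemma dmapB : zmod_morphism (dmap f).
Proof. by apply: dliftB => i u v; rewrite fB raddfB. Qed.

Lemma dmap_inj i (v : V i) : dmap f (dinj v) = dinj (f v).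
Proof. by rewrite /dmap dlift_inj // => j u w; rewrite fB raddfB. Qed.

End Map.
End DirectSum.

Section Bimodules.
Variables (k : fieldType) (S : algType k).

(* S-S-bimodules over k: k acts in the same way on both sides, i.e. modules *)
(* over the tensor product of S and its opposite over k.                    *)
Record bimod := Bimod {
  bcar :> zmodType;
  bl : S -> bcar -> bcar;
  br : bcar -> S -> bcar;
  blDr : forall s, {morph bl s : x y / x + y};
  blDl : forall x, {morph bl^~ x : s t / s + t};
  blA : forall s t x, bl s (bl t x) = bl (s * t) x;
  bl1 : forall x, bl 1 x = x;
  brDl : forall s, {morph br^~ s : x y / x + y};
  brDr : forall x, {morph br x : s t / s + t};
  brA : forall s t x, br (br x s) t = br x (s * t);
  br1 : forall x, br x 1 = x;
  blr : forall s t x, br (bl s x) t = bl s (br x t);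
  bk : forall (c : k) x, bl c%:A x = br x c%:A }.

Definition sub_bimod (P Q : ideal S) (X : bimod) (W : set X) : Prop :=
  [/\ subgroup W,
      forall a x, ideal_set P a -> W x -> W (bl a x) &
      forall b x, ideal_set Q b -> W x -> W (br x b)].

(* P.X.Q *)
Definition bimod_cut (P : ideal S) (X : bimod) (Q : ideal S) : set X :=
  gspan [set y | exists a x b,
    [/\ ideal_set P a, ideal_set Q b & y = br (bl a x) b]].

Definition bimod_gen (P Q : ideal S) (X : bimod) (G : set X) : set X :=
  [set x | forall W : set X, sub_bimod P Q W -> G `<=` W -> W x].

Definition generated_by (P Q : ideal S) (X : bimod) (n : nat) : Prop :=
  exists g : 'I_n -> X, bimod_gen P Q (range g) = @bimod_cut P X Q.

Definition min_generators (P Q : ideal S) (X : bimod) (n : nat) : Prop :=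
  generated_by P Q X n /\ forall m, generated_by P Q X m -> (n <= m)%N.

End Bimodules.

Section RadicalQuotient.
Variables (k : fieldType) (A : algType k).

Definition radquot : algType k := quotalg (@rad_proper A).

Definition splits_over_radical : Prop :=
  exists rho : {lrmorphism radquot -> A},
    forall x : radquot, qproj (@rad_proper A) (rho x) = x.


Local Notation r := (rad A).

Definition rad2_pred : {pred ideal_type r} :=
  fun x => `[< mulset (ideal_set r) (ideal_set r) (ideal_val x) >].

Fact rad2_zmod_closed : zmod_closed rad2_pred.
Proof.
split; first by apply/asboolP; exact: (gspan_subgroup _).1.
move=> x y /asboolP Gx /asboolP Gy; apply/asboolP.
exact: (gspan_subgroup _).2.
Qed.

HB.instance Definition _ :=
  GRing.isZmodClosed.Build (ideal_type r) rad2_pred rad2_zmod_closed.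

Local Notation rr2 := (zquot rad2_pred).
Local Notation cls := (zq rad2_pred).

Lemma rad2_mul a b : ideal_set r a -> ideal_set r b ->
  mulset (ideal_set r) (ideal_set r) (a * b).
Proof. by move=> ra rb; apply: sub_gspan; exists a, b. Qed.

Lemma rad2_mull a x : mulset (ideal_set r) (ideal_set r) x ->
  mulset (ideal_set r) (ideal_set r) (a * x).
Proof.
apply: (gspan_min (W := [set y | mulset (ideal_set r) (ideal_set r) (a * y)])).
  split=> [|y z /= Gy Gz]; first by rewrite /= mulr0; exact: (gspan_subgroup _).1.
  by rewrite mulrBr; exact: (gspan_subgroup _).2.
move=> _ [y [z [ry rz ->]]] /=; rewrite mulrA.
by apply: rad2_mul => //; exact: ideal_mull.
Qed.

Lemma rad2_mulr a x : mulset (ideal_set r) (ideal_set r) x ->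
  mulset (ideal_set r) (ideal_set r) (x * a).
Proof.
apply: (gspan_min (W := [set y | mulset (ideal_set r) (ideal_set r) (y * a)])).
  split=> [|y z /= Gy Gz]; first by rewrite /= mul0r; exact: (gspan_subgroup _).1.
  by rewrite mulrBl; exact: (gspan_subgroup _).2.
move=> _ [y [z [ry rz ->]]] /=; rewrite -mulrA.
by apply: rad2_mul => //; exact: ideal_mulr.
Qed.

Lemma rad2P (x y : ideal_type r) :
  mulset (ideal_set r) (ideal_set r) (ideal_val x - ideal_val y) ->
  cls x = cls y.
Proof. by move=> xy; apply/zqP/asboolP. Qed.

Lemma rad2_repB x : mulset (ideal_set r) (ideal_set r)
  (ideal_val (zrep (cls x)) - ideal_val x).
Proof. exact/asboolP/(zrepB rad2_pred x). Qed.

Definition rr2_l (s : radquot) (x : rr2) : rr2 := cls (ilmul (qrep s) (zrep x)).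
Definition rr2_r (x : rr2) (s : radquot) : rr2 := cls (irmul (zrep x) (qrep s)).

Local Notation proj := (qproj (@rad_proper A)).

Lemma rr2_lE a x : rr2_l (proj a) (cls x) = cls (ilmul a x).
Proof.
apply: rad2P => /=; set a' := qrep _; set x' := zrep _.
have -> : a' * ideal_val x' - a * ideal_val x
    = (a' - a) * ideal_val x' + a * (ideal_val x' - ideal_val x).
  by rewrite mulrBl mulrBr addrA subrK.
apply: (subgroupD (gspan_subgroup _)).
  by apply: rad2_mul; [exact: qrepB | exact: ideal_valP].
by apply: rad2_mull; exact: rad2_repB.
Qed.

Lemma rr2_rE a x : rr2_r (cls x) (proj a) = cls (irmul x a).
Proof.
apply: rad2P => /=; set a' := qrep _; set x' := zrep _.
have -> : ideal_val x' * a' - ideal_val x * a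
    = ideal_val x' * (a' - a) + (ideal_val x' - ideal_val x) * a.
  by rewrite mulrBr mulrBl addrA subrK.
apply: (subgroupD (gspan_subgroup _)).
  by apply: rad2_mul; [exact: ideal_valP | exact: qrepB].
by apply: rad2_mulr; exact: rad2_repB.
Qed.

Fact rr2_lDr s : {morph rr2_l s : x y / x + y}.
Proof.
move=> x y; rewrite -[s]qrepK -[x]zrepK -[y]zrepK -raddfD !rr2_lE.
by rewrite ilmulDr raddfD.
Qed.
Fact rr2_lDl x : {morph rr2_l^~ x : s t / s + t}.
Proof.
move=> s t; rewrite -[s]qrepK -[t]qrepK -[x]zrepK -raddfD !rr2_lE.
by rewrite ilmulDl raddfD.
Qed.
Fact rr2_lA s t x : rr2_l s (rr2_l t x) = rr2_l (s * t) x.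
Proof.
rewrite -[s]qrepK -[t]qrepK -[x]zrepK.
by rewrite -rmorphM !rr2_lE ilmulA.
Qed.
Fact rr2_l1 x : rr2_l 1 x = x.
Proof. by rewrite -[x]zrepK -(rmorph1 proj) rr2_lE ilmul1. Qed.
Fact rr2_rDl s : {morph rr2_r^~ s : x y / x + y}.
Proof.
move=> x y; rewrite -[s]qrepK -[x]zrepK -[y]zrepK -raddfD !rr2_rE.
by rewrite irmulDl raddfD.
Qed.
Fact rr2_rDr x : {morph rr2_r x : s t / s + t}.
Proof.
move=> s t; rewrite -[s]qrepK -[t]qrepK -[x]zrepK -raddfD !rr2_rE.
by rewrite irmulDr raddfD.
Qed.
Fact rr2_rA s t x : rr2_r (rr2_r x s) t = rr2_r x (s * t).
Proof.
rewrite -[s]qrepK -[t]qrepK -[x]zrepK.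
by rewrite -rmorphM !rr2_rE irmulA.
Qed.
Fact rr2_r1 x : rr2_r x 1 = x.
Proof. by rewrite -[x]zrepK -(rmorph1 proj) rr2_rE irmul1. Qed.
Fact rr2_lr s t x : rr2_r (rr2_l s x) t = rr2_l s (rr2_r x t).
Proof.
rewrite -[s]qrepK -[t]qrepK -[x]zrepK.
by rewrite rr2_lE !rr2_rE rr2_lE ilrmul.
Qed.
Fact rr2_k (c : k) x : rr2_l c%:A x = rr2_r x c%:A.
Proof.
rewrite -[x]zrepK -(rmorph_alg proj) rr2_lE rr2_rE; congr cls.
by apply: val_inj; rewrite /= mulr_algl mulr_algr.
Qed.

Definition rad_rad2 : bimod radquot :=
  Bimod rr2_lDr rr2_lDl rr2_lA rr2_l1 rr2_rDl rr2_rDr rr2_rA rr2_r1 rr2_lr rr2_k.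

End RadicalQuotient.

Section BimoduleConstructions.
Variables (k : fieldType) (S : algType k).

Section IdealTensor.
Variables P Q : ideal S.

Definition ikl (c : k) (y : ideal_type Q) : ideal_type Q := ilmul c%:A y.
Definition ikr (x : ideal_type P) (c : k) : ideal_type P := ilmul c%:A x.

Local Notation PQ := (tensor ikr ikl).

Definition it_l (s : S) : PQ -> PQ := tmap (ilmul s) id.
Definition it_r (z : PQ) (s : S) : PQ := tmap id (fun y => irmul y s) z.

Let algC (c : k) (s : S) : c%:A * s = s * c%:A.
Proof. by rewrite mulr_algl mulr_algr. Qed.

Let lM s (x : ideal_type P) c : ilmul s (ikr x c) = ikr (ilmul s x) c.
Proof. by rewrite /ikr !ilmulA algC. Qed.

Let rM s c (y : ideal_type Q) : irmul (ikl c y) s = ikl c (irmul y s).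
Proof. by rewrite /ikl ilrmul. Qed.

Let it_lP s x y : it_l s (tpure ikr ikl x y) = tpure ikr ikl (ilmul s x) y.
Proof. by apply: tmap_pure => //; exact: ilmulDr. Qed.

Let it_rP s x y : it_r (tpure ikr ikl x y) s = tpure ikr ikl x (irmul y s).
Proof. by apply: tmap_pure => //; exact: irmulDl. Qed.

Let it_lB s : zmod_morphism (it_l s).
Proof. by apply: tmapB => //; exact: ilmulDr. Qed.

Let it_rB s : zmod_morphism (it_r^~ s).
Proof. by apply: tmapB => //; exact: irmulDl. Qed.

Let addB (f g : PQ -> PQ) : zmod_morphism f -> zmod_morphism g ->
  zmod_morphism (fun z => f z + g z).
Proof. by move=> fB gB x y; rewrite fB gB opprD addrACA. Qed.

Let compB (f g : PQ -> PQ) : zmod_morphism f -> zmod_morphism g ->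
  zmod_morphism (fun z => f (g z)).
Proof. by move=> fB gB x y; rewrite gB fB. Qed.

Let idB : zmod_morphism (fun z : PQ => z). Proof. by []. Qed.

Fact it_lDr s : {morph it_l s : x y / x + y}.
Proof. exact: zmodmorD (it_lB s). Qed.
Fact it_lDl z : {morph it_l^~ z : s t / s + t}.
Proof.
move=> s t; move: z; apply: eq_tensor => [||x y] //; first exact: addB.
by rewrite !it_lP ilmulDl tpureDl.
Qed.
Fact it_lA s t z : it_l s (it_l t z) = it_l (s * t) z.
Proof.
move: z; apply: eq_tensor => [||x y] //; first exact: compB.
by rewrite !it_lP ilmulA.
Qed.
Fact it_l1 z : it_l 1 z = z.
Proof. by move: z; apply: eq_tensor => [||x y] //; rewrite it_lP ilmul1. Qed.
Fact it_rDl s : {morph it_r^~ s : x y / x + y}.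
Proof. exact: zmodmorD (it_rB s). Qed.
Fact it_rDr z : {morph it_r z : s t / s + t}.
Proof.
move=> s t; move: z; apply: eq_tensor => [||x y] //; first exact: addB.
by rewrite !it_rP irmulDr tpureDr.
Qed.
Fact it_rA s t z : it_r (it_r z s) t = it_r z (s * t).
Proof.
move: z; apply: eq_tensor => [||x y] //; first exact: (compB (it_rB t) (it_rB s)).
by rewrite !it_rP irmulA.
Qed.
Fact it_r1 z : it_r z 1 = z.
Proof. by move: z; apply: eq_tensor => [||x y] //; rewrite it_rP irmul1. Qed.
Fact it_lr s t z : it_r (it_l s z) t = it_l s (it_r z t).
Proof.
move: z; apply: eq_tensor => [||x y]; first exact: (compB (it_rB t) (it_lB s)).
  exact: (compB (it_lB s) (it_rB t)).
by rewrite !(it_lP, it_rP).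
Qed.
Fact it_k (c : k) z : it_l c%:A z = it_r z c%:A.
Proof.
move: z; apply: eq_tensor => [||x y] //.
rewrite it_lP it_rP -[ilmul c%:A x]/(ikr x c) tpureM; congr tpure.
by apply: val_inj; exact: algC.
Qed.

(* The tensor product over k of P and Q: the free P-Q-bimodule on one *)
(* generator.                                                         *)
Definition ideal_tensor : bimod S :=
  Bimod it_lDr it_lDl it_lA it_l1 it_rDl it_rDr it_rA it_r1 it_lr it_k.

End IdealTensor.

Section DirectSumBimodule.
Variables (I : choiceType) (X : I -> bimod S).

Local Notation DS := (dsum (fun i => X i : zmodType)).

Let lB s i : zmod_morphism (fun x : X i => bl s x).
Proof. exact/zmod_morphismI/blDr. Qed.
Let rB s i : zmod_morphism (fun x : X i => br x s).
Proof. exact/zmod_morphismI/brDl. Qed.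

Definition ds_l (s : S) : DS -> DS := dmap (fun i (x : X i) => bl s x).
Definition ds_r (x : DS) (s : S) : DS := dmap (fun i (x : X i) => br x s) x.

Let ds_lB s : zmod_morphism (ds_l s).
Proof. by apply: dmapB => i; exact: lB. Qed.
Let ds_rB s : zmod_morphism (ds_r^~ s).
Proof. by apply: dmapB => i; exact: rB. Qed.

Let ds_lI s i (x : X i) : ds_l s (dinj (x : (fun i => X i : zmodType) i)) = dinj (bl s x).
Proof. by apply: dmap_inj => j; exact: lB. Qed.
Let ds_rI s i (x : X i) : ds_r (dinj (x : (fun i => X i : zmodType) i)) s = dinj (br x s).
Proof. by apply: (dmap_inj (f := fun i (x : X i) => br x s)) => j; exact: rB. Qed.

Let addB (f g : DS -> DS) : zmod_morphism f -> zmod_morphism g ->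
  zmod_morphism (fun z => f z + g z).
Proof. by move=> fB gB x y; rewrite fB gB opprD addrACA. Qed.

Let compB (f g : DS -> DS) : zmod_morphism f -> zmod_morphism g ->
  zmod_morphism (fun z => f (g z)).
Proof. by move=> fB gB x y; rewrite gB fB. Qed.

Let idB : zmod_morphism (fun z : DS => z). Proof. by []. Qed.

Fact ds_lDr s : {morph ds_l s : x y / x + y}.
Proof. exact: zmodmorD (ds_lB s). Qed.
Fact ds_lDl z : {morph ds_l^~ z : s t / s + t}.
Proof.
move=> s t; move: z; apply: eq_dsum => [||i x] //; first exact: addB.
by rewrite !ds_lI blDl raddfD.
Qed.
Fact ds_lA s t z : ds_l s (ds_l t z) = ds_l (s * t) z.
Proof.
move: z; apply: eq_dsum => [||i x] //; first exact: compB.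
by rewrite !ds_lI blA.
Qed.
Fact ds_l1 z : ds_l 1 z = z.
Proof. by move: z; apply: eq_dsum => [||i x] //; rewrite ds_lI bl1. Qed.
Fact ds_rDl s : {morph ds_r^~ s : x y / x + y}.
Proof. exact: zmodmorD (ds_rB s). Qed.
Fact ds_rDr z : {morph ds_r z : s t / s + t}.
Proof.
move=> s t; move: z; apply: eq_dsum => [||i x] //; first exact: addB.
by rewrite !ds_rI brDr raddfD.
Qed.
Fact ds_rA s t z : ds_r (ds_r z s) t = ds_r z (s * t).
Proof.
move: z; apply: eq_dsum => [||i x] //; first exact: (compB (ds_rB t) (ds_rB s)).
by rewrite !ds_rI brA.
Qed.
Fact ds_r1 z : ds_r z 1 = z.
Proof. by move: z; apply: eq_dsum => [||i x] //; rewrite ds_rI br1. Qed.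
Fact ds_lr s t z : ds_r (ds_l s z) t = ds_l s (ds_r z t).
Proof.
move: z; apply: eq_dsum => [||i x]; first exact: (compB (ds_rB t) (ds_lB s)).
  exact: (compB (ds_lB s) (ds_rB t)).
by rewrite !(ds_lI, ds_rI) blr.
Qed.
Fact ds_k (c : k) z : ds_l c%:A z = ds_r z c%:A.
Proof.
by move: z; apply: eq_dsum => [||i x] //; rewrite ds_lI ds_rI bk.
Qed.

Definition bimod_sum : bimod S :=
  Bimod ds_lDr ds_lDl ds_lA ds_l1 ds_rDl ds_rDr ds_rA ds_r1 ds_lr ds_k.

End DirectSumBimodule.

Section TensorOver.
Variables (M : bimod S) (N : lmodType S).

Definition tensor_over : Type :=
  tensor (@br k S M) (fun (s : S) (y : N) => s *: y).
HB.instance Definition _ := GRing.Zmodule.copy tensor_over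
  (tensor (@br k S M) (fun (s : S) (y : N) => s *: y)).

Definition tover (m : M) (y : N) : tensor_over :=
  tpure (@br k S M) (fun (s : S) (y : N) => s *: y) m y.

Lemma toverDl m m' y : tover (m + m') y = tover m y + tover m' y.
Proof. exact: tpureDl. Qed.
Lemma toverDr m y y' : tover m (y + y') = tover m y + tover m y'.
Proof. exact: tpureDr. Qed.
Lemma toverM m s y : tover (br m s) y = tover m (s *: y).
Proof. exact: tpureM. Qed.

Definition to_scale (s : S) : tensor_over -> tensor_over := tmap (bl s) id.

Let lM s (x : M) t : bl s (br x t) = br (bl s x) t.
Proof. by rewrite blr. Qed.

Let to_scaleP s x y : to_scale s (tover x y) = tover (bl s x) y.
Proof. by apply: tmap_pure => //; exact: blDr. Qed.

Let to_scaleB s : zmod_morphism (to_scale s).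
Proof. by apply: tmapB => //; exact: blDr. Qed.

Fact to_scaleA s t z : to_scale s (to_scale t z) = to_scale (s * t) z.
Proof.
move: z; apply: eq_tensor => [||x y] //.
  by move=> u v /=; rewrite !to_scaleB.
by rewrite -/(tover x y) !to_scaleP blA.
Qed.

Fact to_scale1 : left_id 1 to_scale.
Proof.
move=> z; move: z; apply: eq_tensor => [||x y] //.
by rewrite -/(tover x y) !to_scaleP bl1.
Qed.

Fact to_scaleDr : right_distributive to_scale +%R.
Proof. by move=> s; exact: zmodmorD (to_scaleB s). Qed.

Fact to_scaleDl z : {morph to_scale^~ z : s t / s + t}.
Proof.
move=> s t; move: z; apply: eq_tensor => [||x y] //.
  by move=> u v /=; rewrite !to_scaleB opprD addrACA.
by rewrite -/(tover x y) !to_scaleP blDl toverDl.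
Qed.

HB.instance Definition _ := GRing.Zmodule_isLmodule.Build S tensor_over
  to_scaleA to_scale1 to_scaleDr to_scaleDl.

Lemma toverZ s m y : s *: tover m y = tover (bl s m) y.
Proof. exact: to_scaleP. Qed.

End TensorOver.

(* The n-th tensor power of M over S, as a left S-module; the 0-th one is S *)
(* and the (n+1)-st one is the tensor product over S of M and the n-th one. *)
Fixpoint tpow (M : bimod S) (n : nat) : lmodType S :=
  if n is m.+1 then tensor_over M (tpow M m) : lmodType S else S^o.

End BimoduleConstructions.

Section TensorAlgebra.
Variables (k : fieldType) (S : algType k) (M : bimod S).

Definition tpowz (n : nat) : zmodType := tpow M n.

Definition tensor_algebra : Type := dsum tpowz.
Local Notation T := tensor_algebra.
HB.instance Definition _ := GRing.Zmodule.copy T (dsum tpowz).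

Definition tinj (n : nat) (z : tpow M n) : T := @dinj _ tpowz n z.

Lemma tinjB n : zmod_morphism (@tinj n).
Proof. exact: dinj_is_zmod_morphism. Qed.

Definition ta_scale (s : S) : T -> T :=
  dlift (fun n (y : tpowz n) => tinj (s *: (y : tpow M n))).

Definition ta_shift (m : M) : T -> T :=
  dlift (fun n (y : tpowz n) => @tinj n.+1 (tover m (y : tpow M n))).

(* The left multiplication by an element of the n-th tensor power: the *)
(* product of x1 (x) ... (x) xn with t is x1 (x) (... (x) (xn (x) t)).  *)
Fixpoint ta_act (n : nat) : tpow M n -> T -> T :=
  match n return tpow M n -> T -> T with
  | 0 => fun s t => ta_scale s t
  | m.+1 => fun z t => tlift (fun x y => ta_shift x (@ta_act m y t)) z
  end.

Definition ta_mul (x t : T) : T :=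
  dlift (fun n (z : tpowz n) => @ta_act n z t) x.

Definition ta_one : T := @tinj 0 (1 : S).

Let addB (f g : T -> T) : zmod_morphism f -> zmod_morphism g ->
  zmod_morphism (fun z => f z + g z).
Proof. by move=> fB gB x y; rewrite fB gB opprD addrACA. Qed.

Let subB (U : zmodType) (f g : U -> T) : zmod_morphism f ->
  zmod_morphism g -> zmod_morphism (fun z => f z - g z).
Proof.
move=> fB gB x y; rewrite fB gB !opprB -!addrA; congr (_ + _).
by rewrite addrCA [RHS]addrCA; congr (_ + _); rewrite addrC.
Qed.

Let compB (U V W : zmodType) (f : V -> W) (g : U -> V) :
  zmod_morphism f -> zmod_morphism g -> zmod_morphism (fun z => f (g z)).
Proof. by move=> fB gB x y; rewrite gB fB. Qed.

Let idB (U : zmodType) : zmod_morphism (fun z : U => z). Proof. by []. Qed.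

Lemma eq_ta (f g : T -> T) : zmod_morphism f -> zmod_morphism g ->
  (forall n (z : tpow M n), f (tinj z) = g (tinj z)) -> f =1 g.
Proof. exact: eq_dsum. Qed.

Lemma eq_tp n (f g : tpow M n.+1 -> T) : zmod_morphism f -> zmod_morphism g ->
  (forall x (y : tpow M n), f (tover x y) = g (tover x y)) -> f =1 g.
Proof. exact: eq_tensor. Qed.

Let scaleB n (s : S) : zmod_morphism (fun y : tpowz n => tinj (s *: (y : tpow M n))).
Proof. by move=> x y; rewrite (scalerBr s (x : tpow M n)) tinjB. Qed.

Let shiftB n (m : M) :
  zmod_morphism (fun y : tpowz n => @tinj n.+1 (tover m (y : tpow M n))).
Proof.
by apply: zmod_morphismI => x y; rewrite toverDr (zmodmorD (@tinjB n.+1)).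
Qed.

Lemma ta_scaleB s : zmod_morphism (ta_scale s).
Proof. by apply: dliftB => n; exact: scaleB. Qed.

Lemma ta_shiftB m : zmod_morphism (ta_shift m).
Proof. by apply: dliftB => n; exact: shiftB. Qed.

Lemma ta_scale_inj s n (y : tpow M n) : ta_scale s (tinj y) = tinj (s *: y).
Proof.
by rewrite /ta_scale [LHS](dlift_inj (V := tpowz)) // => i; exact: scaleB.
Qed.

Lemma ta_shift_inj m n (y : tpow M n) :
  ta_shift m (tinj y) = @tinj n.+1 (tover m y).
Proof.
by rewrite /ta_shift [LHS](dlift_inj (V := tpowz)) // => i; exact: shiftB.
Qed.

Lemma ta_scaleDl s t x : ta_scale (s + t) x = ta_scale s x + ta_scale t x.
Proof.
move: x; apply: eq_ta; [exact: ta_scaleB | apply: addB; exact: ta_scaleB |].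
by move=> n z; rewrite !ta_scale_inj scalerDl (zmodmorD (@tinjB n)).
Qed.

Lemma ta_scaleA s t x : ta_scale s (ta_scale t x) = ta_scale (s * t) x.
Proof.
move: x; apply: eq_ta; [apply: compB; exact: ta_scaleB | exact: ta_scaleB |].
by move=> n z; rewrite !ta_scale_inj scalerA.
Qed.

Lemma ta_scale1 x : ta_scale 1 x = x.
Proof.
move: x; apply: eq_ta; [exact: ta_scaleB | exact: idB |].
by move=> n z; rewrite !ta_scale_inj scale1r.
Qed.

Lemma ta_shiftDl m m' x : ta_shift (m + m') x = ta_shift m x + ta_shift m' x.
Proof.
move: x; apply: eq_ta; [exact: ta_shiftB | apply: addB; exact: ta_shiftB |].
by move=> n z; rewrite !ta_shift_inj toverDl (zmodmorD (@tinjB n.+1)).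
Qed.

Lemma ta_shift_br m s x : ta_shift (br m s) x = ta_shift m (ta_scale s x).
Proof.
move: x; apply: eq_ta; [exact: ta_shiftB | |].
  by apply: compB; [exact: ta_shiftB | exact: ta_scaleB].
by move=> n z; rewrite ta_scale_inj !ta_shift_inj toverM.
Qed.

Lemma ta_shift_bl m s x : ta_shift (bl s m) x = ta_scale s (ta_shift m x).
Proof.
move: x; apply: eq_ta; [exact: ta_shiftB | |].
  by apply: compB; [exact: ta_scaleB | exact: ta_shiftB].
by move=> n z; rewrite !ta_shift_inj ta_scale_inj toverZ.
Qed.

Let act_spec n := (forall t, zmod_morphism (fun z : tpow M n => ta_act z t)) /\
  (forall s (z : tpow M n) t, ta_act (s *: z) t = ta_scale s (ta_act z t)).

Let act_overP n : act_spec n -> forall m (y : tpow M n) t,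
  @ta_act n.+1 (tover m y) t = ta_shift m (ta_act y t).
Proof.
move=> [actB actZ] m y t; apply: tlift_pure => [x x' z|x z z'|x s z].
- exact: ta_shiftDl.
- rewrite -(zmodmorD (ta_shiftB x)); congr (ta_shift x _).
  exact: (zmodmorD (actB t)).
- rewrite ta_shift_br; congr (ta_shift x _); exact/esym/actZ.
Qed.

Let act_overB n : act_spec n -> forall t,
  zmod_morphism (fun z : tpow M n.+1 => ta_act z t).
Proof.
move=> [actB actZ] t; apply: tliftB => [x x' z|x z z'|x s z].
- exact: ta_shiftDl.
- rewrite -(zmodmorD (ta_shiftB x)); congr (ta_shift x _).
  exact: (zmodmorD (actB t)).
- rewrite ta_shift_br; congr (ta_shift x _); exact/esym/actZ.
Qed.

Let actP n : act_spec n.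
Proof.
elim: n => [|n IHn].
  split=> [t|s z t]; last by rewrite /= ta_scaleA.
  by apply: zmod_morphismI => x y; exact: ta_scaleDl.
split=> [|s z t]; first exact: act_overB.
move: z; apply: eq_tp.
- move=> u v; rewrite scalerBr; exact: act_overB.
- by apply: compB; [exact: ta_scaleB | exact: act_overB].
by move=> x y; rewrite toverZ !act_overP // ta_shift_bl.
Qed.

Lemma ta_actBl n t : zmod_morphism (fun z : tpow M n => ta_act z t).
Proof. exact: (actP n).1. Qed.

Lemma ta_actZ n s (z : tpow M n) t :
  ta_act (s *: z) t = ta_scale s (ta_act z t).
Proof. exact: (actP n).2. Qed.

Lemma ta_act_over n m (y : tpow M n) t :
  @ta_act n.+1 (tover m y) t = ta_shift m (ta_act y t).
Proof. exact: (act_overP (actP n)). Qed.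

Lemma ta_actBr n (z : tpow M n) : zmod_morphism (ta_act z).
Proof.
elim: n z => [|n IHn] z x y; first exact: ta_scaleB.
move: z; apply: eq_tp; first exact: ta_actBl.
  by apply: subB; exact: ta_actBl.
by move=> m z; rewrite !ta_act_over IHn ta_shiftB.
Qed.

Lemma ta_mulBl t : zmod_morphism (ta_mul^~ t).
Proof. by apply: dliftB => n; exact: ta_actBl. Qed.

Lemma ta_mul_inj n (z : tpow M n) t : ta_mul (tinj z) t = ta_act z t.
Proof.
rewrite /ta_mul.
exact: (dlift_inj (f := fun n (z : tpowz n) => @ta_act n z t)
                  (fun n => @ta_actBl n t)).
Qed.

Lemma ta_mulBr x : zmod_morphism (ta_mul x).
Proof.
move=> y z; move: x; apply: eq_ta; first exact: ta_mulBl.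
  by apply: subB; exact: ta_mulBl.
by move=> n u; rewrite !ta_mul_inj ta_actBr.
Qed.

Lemma ta_scale_mul s x y : ta_mul (ta_scale s x) y = ta_scale s (ta_mul x y).
Proof.
move: x; apply: eq_ta.
- by apply: (compB (ta_mulBl y)); exact: ta_scaleB.
- by apply: (compB (ta_scaleB s)); exact: ta_mulBl.
by move=> n z; rewrite ta_scale_inj !ta_mul_inj ta_actZ.
Qed.

Lemma ta_shift_mul m x y : ta_mul (ta_shift m x) y = ta_shift m (ta_mul x y).
Proof.
move: x; apply: eq_ta.
- by apply: (compB (ta_mulBl y)); exact: ta_shiftB.
- by apply: (compB (ta_shiftB m)); exact: ta_mulBl.
by move=> n z; rewrite ta_shift_inj !ta_mul_inj ta_act_over.
Qed.

Lemma ta_act_mul n (z : tpow M n) x y :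
  ta_mul (ta_act z x) y = ta_act z (ta_mul x y).
Proof.
elim: n z => [|n IHn]; first by move=> z; exact: ta_scale_mul.
apply: eq_tp.
- by apply: (compB (ta_mulBl y)); exact: ta_actBl.
- exact: ta_actBl.
by move=> m z; rewrite !ta_act_over ta_shift_mul IHn.
Qed.

Fact ta_mulA : associative ta_mul.
Proof.
move=> x y z; move: x; apply: eq_ta; first exact: ta_mulBl.
  by apply: (compB (ta_mulBl z)); exact: ta_mulBl.
by move=> n u; rewrite !ta_mul_inj ta_act_mul.
Qed.

Fact ta_mul1 : left_id ta_one ta_mul.
Proof. by move=> x; rewrite ta_mul_inj; exact: ta_scale1. Qed.

Lemma ta_act1 n (z : tpow M n) : ta_act z ta_one = tinj z.
Proof.
elim: n z => [|n IHn].
  by move=> z; rewrite [LHS]ta_scale_inj; congr tinj; exact: mulr1.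
apply: eq_tp; [exact: ta_actBl | exact: tinjB |].
by move=> m z; rewrite ta_act_over IHn ta_shift_inj.
Qed.

Fact ta_mulr1 : right_id ta_one ta_mul.
Proof.
apply: eq_ta; [exact: ta_mulBl | exact: idB |].
by move=> n z; rewrite ta_mul_inj ta_act1.
Qed.

Fact ta_mulDl : left_distributive ta_mul +%R.
Proof. by move=> x y z; exact: (zmodmorD (ta_mulBl z)). Qed.

Fact ta_mulDr : right_distributive ta_mul +%R.
Proof. by move=> x y z; exact: (zmodmorD (ta_mulBr x)). Qed.

Fact ta_one_neq0 : ta_one != 0.
Proof.
apply/eqP => /(congr1 (fun x : dsum tpowz => x 0)).
rewrite (@dinj_in _ tpowz 0) => /eqP.
by apply/negP; exact: (oner_neq0 S).
Qed.

HB.instance Definition _ := GRing.Zmodule_isNzRing.Build T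
  ta_mulA ta_mul1 ta_mulr1 ta_mulDl ta_mulDr ta_one_neq0.

Definition ta_kscale (c : k) (x : T) : T := ta_scale c%:A x.

Fact ta_kscaleA a b x : ta_kscale a (ta_kscale b x) = ta_kscale (a * b) x.
Proof. by rewrite /ta_kscale ta_scaleA mulr_algl scalerA. Qed.

Fact ta_kscale1 : left_id 1 ta_kscale.
Proof. by move=> x; rewrite /ta_kscale scale1r ta_scale1. Qed.

Fact ta_kscaleDr : right_distributive ta_kscale +%R.
Proof. by move=> c; exact: (zmodmorD (ta_scaleB _)). Qed.

Fact ta_kscaleDl x : {morph ta_kscale^~ x : a b / a + b}.
Proof. by move=> a b; rewrite /ta_kscale scalerDl ta_scaleDl. Qed.

HB.instance Definition _ := GRing.Zmodule_isLmodule.Build k T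
  ta_kscaleA ta_kscale1 ta_kscaleDr ta_kscaleDl.

Fact ta_kscaleAl (a : k) (x y : T) : a *: (x * y) = (a *: x) * y.
Proof. by rewrite [RHS]ta_scale_mul. Qed.

Lemma ta_act_kscale (c : k) n (z : tpow M n) x :
  ta_kscale c (ta_act z x) = ta_act z (ta_kscale c x).
Proof.
rewrite /ta_kscale; elim: n z => [|n IHn].
  by move=> s; rewrite /= !ta_scaleA mulr_algl mulr_algr.
apply: eq_tp.
- by apply: (compB (ta_scaleB _)); exact: ta_actBl.
- exact: ta_actBl.
by move=> m z; rewrite !ta_act_over -ta_shift_bl bk ta_shift_br IHn.
Qed.

Fact ta_kscaleAr (a : k) (x y : T) : a *: (x * y) = x * (a *: y).
Proof.
change (ta_kscale a (ta_mul x y) = ta_mul x (ta_kscale a y)).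
move: x; apply: eq_ta; [|exact: ta_mulBl|].
  by apply: (compB (ta_scaleB _)); exact: ta_mulBl.
by move=> n z; rewrite !ta_mul_inj ta_act_kscale.
Qed.

HB.instance Definition _ := GRing.Lmodule_isLalgebra.Build k T ta_kscaleAl.
HB.instance Definition _ := GRing.Lalgebra_isAlgebra.Build k T ta_kscaleAr.

(* The virtual paths of length 1. *)
Definition degree_one : set T := range (@tinj 1).

Definition path_ideal : set T := ideal_gen degree_one.

Local Notation cf0 x := ((x : dsum tpowz) 0).

Lemma cf0B (x y : T) : cf0 (x - y) = (cf0 x : S) - (cf0 y : S) :> S.
Proof. by []. Qed.

Lemma ta_coef0M (x y : T) : cf0 (x * y) = (cf0 x : S) * (cf0 y : S) :> S.
Proof.
have shift0 m z : cf0 (ta_shift m z) = 0.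
  move: z; apply: (eq_dsum (G := S)) => [u v|u v|n z].
  - by rewrite ta_shiftB.
  - by rewrite subr0.
  by rewrite [ta_shift _ _]ta_shift_inj; exact: (@dinj_out _ tpowz n.+1 0).
have scale0 s z : cf0 (ta_scale s z) = s * (cf0 z : S).
  move: z; apply: (eq_dsum (G := S)) => [u v|u v|n z].
  - by rewrite ta_scaleB.
  - by rewrite dcoefB mulrBr.
  rewrite [ta_scale _ _]ta_scale_inj; case: n z => [|n] z.
    by rewrite !(@dinj_in _ tpowz 0).
  by rewrite !(@dinj_out _ tpowz n.+1 0) // mulr0.
move: x; apply: (eq_dsum (G := S)) => [u v|u v|n z].
- by rewrite mulrBl.
- by rewrite dcoefB mulrBl.
rewrite [_ * _]ta_mul_inj; case: n z => [|n] z.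
  by rewrite (@dinj_in _ tpowz 0) [ta_act _ _]/=; exact: scale0.
rewrite (@dinj_out _ tpowz n.+1 0) // mul0r.
move: z; apply: (eq_tensor (G := S)) => [u v|u v|m z].
- by rewrite (@ta_actBl n.+1).
- by rewrite subr0.
by rewrite [ta_act _ _](ta_act_over m z); exact: shift0.
Qed.

(* The ideal generated by the paths of length 1 is the direct sum of the *)
(* tensor powers of positive degree.                                     *)
Lemma path_idealE (x : T) : path_ideal x <-> cf0 x = 0.
Proof.
split=> [Jx|x0].
  have K0 : subgroup ([set z | cf0 z = 0] : set T).
    split=> // u v /= u0 v0; apply: (etrans (cf0B u v)).
    by rewrite u0 v0 subr0.
  have Kl (a z : T) : [set z | cf0 z = 0] z -> [set z | cf0 z = 0] (a * z).
    by move=> /= z0; rewrite [LHS]ta_coef0M z0 mulr0.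
  have Kr (a z : T) : [set z | cf0 z = 0] z -> [set z | cf0 z = 0] (z * a).
    by move=> /= z0; rewrite [LHS]ta_coef0M z0 mul0r.
  apply: (Jx (Ideal K0 Kl Kr)) => _ [z _ <-] /=.
  exact: (@dinj_out _ tpowz 1 0).
move=> K dK; have hK := ideal_subgroup K.
have KS n (z : tpow M n.+1) : ideal_set K (@tinj n.+1 z).
  move: z; apply: tensor_ind => [|u v Ku Kv|m y].
  - by rewrite (zmodmor0 (@tinjB n.+1)); exact: hK.1.
  - by rewrite (@tinjB n.+1); exact: hK.2.
  have -> : @tinj n.+1 (tover m y) = @tinj 1 (tover m (1 : S^o)) * tinj y.
    rewrite [RHS]ta_mul_inj ta_act_over -ta_shift_inj; congr ta_shift.
    by rewrite /= ta_scale1.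
  by apply: ideal_mulr; apply: dK; exists (tover m (1 : S^o)).
rewrite [x]dsum_sum; apply: (subgroup_sum _ hK) => -[|n]; last exact: KS.
by rewrite x0 raddf0; exact: hK.1.
Qed.

End TensorAlgebra.

Section GeneralizedPathAlgebra.
Variables (k : fieldType) (A : algType k) (D : finType).
Variables (A_ : D -> ideal (radquot A)) (Omega : D -> D -> finType).

(* Omega i j is the set of arrows from i to j. *)
Definition natural_quiver : Prop :=
  forall i j, min_generators (A_ j) (A_ i) (rad_rad2 A) #|Omega i j|.

Definition arrow : choiceType := {ij : D * D & Omega ij.1 ij.2}.

(* One copy of the free bimodule A_j (x) A_i for every arrow from i to j. *)
Definition arrow_bimod : bimod (radquot A) :=
  bimod_sum (fun a : arrow => ideal_tensor (A_ (tag a).2) (A_ (tag a).1)).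

(* When A/r is the internal direct sum of the ideals A_i, the product algebra *)
(* A_0 of the A_i is A/r itself, so that this is the tensor algebra over A_0.  *)
Definition path_algebra : algType k := tensor_algebra arrow_bimod.

Definition path_J : set path_algebra := @path_ideal k _ arrow_bimod.

End GeneralizedPathAlgebra.

Arguments path_J {k A D} A_ Omega _.

(* Main.v *)
Require Import Defs.
From HB Require Import structures.
From mathcomp Require Import all_boot all_algebra.
From mathcomp Require Import boolp classical_sets.
Import GRing.Theory.
Local Open Scope classical_set_scope.
Local Open Scope ring_scope.

Set Implicit Arguments.
Unset Strict Implicit.
Unset Printing Implicit Defensive.

(* Let T be the path algebra and I = ker pi. As A is hereditary, its ideal    *)
(* pi(J) is projective, so for any ideal K with I J + J I <= K <= I the map   *)
(* J / K -> pi(J) of A-modules has a section h. Then x |-> [x] - h (pi x) is  *)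
(* linear with values in I / K, hence kills J^2 because J I <= K; on I, which *)
(* lies in J^2, it is the class map, so I <= K. Taking for K the elements of  *)
(* I of degree > n, induction on n puts I in arbitrarily high degree.         *)

(** In other words, the exact sequence 0 -> I / K -> J / K -> pi(J) -> 0 of A-modules splits. A
    retraction onto I / K kills J^2, since J annihilates I / K; as I lies in J^2, it kills I too, so
    I / K = 0. This is [hereditary_ker_sub], stated for any surjective ring morphism. The degree
    filtration supplies K: if I has degree at least n, then I J and J I have degree at least n + 1
    by [degree_geM]. An element of a direct sum lying in every step of the filtration is zero, so I
    = 0. *)

Lemma preim_subgroup (U V : zmodType) (g : U -> V) (W : set V) :
  zmod_morphism g -> subgroup W -> subgroup (g @^-1` W).
Proof.
move=> gB [W0 WB]; split=> [|x y Wx Wy]; rewrite /preimage /=.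
  by rewrite zmodmor0.
by rewrite gB; exact: WB.
Qed.

(** * Projectivity of ideals over a hereditary ring *)

Lemma regular_projective (R : nzRingType) : projective (R^o : lmodType R).
Proof.
move=> X Y f g /(_ (g 1)) [x fx].
have hL : linear (fun a : R^o => (a : R) *: x).
  by move=> c a b /=; rewrite scalerDl scalerA.
pose h : {linear R^o -> X} :=
  HB.pack (fun a : R^o => (a : R) *: x) (GRing.isLinear.Build _ _ _ _ _ hL).
exists h => a; rewrite /= linearZ fx -linearZ; congr (g _); exact: mulr1.
Qed.

HB.instance Definition _ (R : nzRingType) (I : ideal R) :=
  GRing.Zmodule_isLmodule.Build R (ideal_type I)
    (@ilmulA R I) (@ilmul1 R I) (@ilmulDr R I) (fun x => @ilmulDl R I x).

Lemma hereditary_ideal (R : nzRingType) (I : ideal R) :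
  hereditary R -> projective (ideal_type I : lmodType R).
Proof.
move=> hR.
have vL : linear (fun x : ideal_type I => (x : R) : R^o) by [].
pose v : {linear ideal_type I -> R^o} :=
  HB.pack (fun x : ideal_type I => (x : R) : R^o)
    (GRing.isLinear.Build _ _ _ _ _ vL).
by apply: (hR _ _ v (@val_inj _ _ _)); exact: regular_projective.
Qed.

(** * The splitting argument for a surjective ring morphism *)

Section Quotient.
Variables (T A : nzRingType) (f : {rmorphism T -> A}) (J K : ideal T).
Hypothesis f_surj : surjective f.

Fact image_subgroup : subgroup [set f x | x in ideal_set J].
Proof.
have [J0 JB] := ideal_subgroup J.
split; first by exists 0; rewrite ?rmorph0.
move=> _ _ [x Jx <-] [y Jy <-].
by exists (x - y); [exact: JB | exact: rmorphB].
Qed.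

Fact image_mull a x : [set f x | x in ideal_set J] x ->
  [set f x | x in ideal_set J] (a * x).
Proof.
have [t <-] := f_surj a; move=> [y Jy <-].
by exists (t * y); [exact: ideal_mull | exact: rmorphM].
Qed.

Fact image_mulr a x : [set f x | x in ideal_set J] x ->
  [set f x | x in ideal_set J] (x * a).
Proof.
have [t <-] := f_surj a; move=> [y Jy <-].
by exists (y * t); [exact: ideal_mulr | exact: rmorphM].
Qed.

Definition image_ideal : ideal A :=
  Ideal image_subgroup image_mull image_mulr.

Definition to_image (x : ideal_type J) : ideal_type image_ideal :=
  @ielt _ image_ideal (f (ideal_val x)) (imageP f (ideal_valP x)).

Lemma to_imageB : zmod_morphism to_image.
Proof. by move=> x y; apply: val_inj; rewrite /= rmorphB. Qed.

Lemma to_imageZ t x : to_image (ilmul t x) = f t *: to_image x.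
Proof. by apply: val_inj; rewrite /= rmorphM. Qed.

(** K is not assumed to lie in J, so the quotient formed is J / (J n K). *)
Definition sub_pred : {pred ideal_type J} :=
  fun x => `[< ideal_set K (ideal_val x) >].

Fact sub_zmod_closed : zmod_closed sub_pred.
Proof.
have [K0 KB] := ideal_subgroup K.
split; first by apply/asboolP.
by move=> x y /asboolP Kx /asboolP Ky; apply/asboolP; exact: KB.
Qed.

HB.instance Definition _ :=
  GRing.isZmodClosed.Build (ideal_type J) sub_pred sub_zmod_closed.

Local Notation Q := (zquot sub_pred).
Local Notation cls := (zq sub_pred).

Lemma clsP (x y : ideal_type J) :
  cls x = cls y <-> ideal_set K (ideal_val x - ideal_val y).
Proof. by split=> [/zqP/asboolP|Kxy]; last exact/zqP/asboolP. Qed.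

Hypothesis kerJ : forall x y, f x = 0 -> ideal_set J y -> ideal_set K (x * y).

(** A mere choice of preimages, compatible with no operation; [quot_scaleE] shows that the action
    does not depend on it. *)
Definition lift_elem (a : A) : T := sval (cid (f_surj a)).

Lemma lift_elemK : cancel lift_elem f.
Proof. by move=> a; exact: svalP (cid (f_surj a)). Qed.

Definition quot_scale (a : A) (x : Q) : Q := cls (ilmul (lift_elem a) (zrep x)).

(** Changing the lift of the scalar adds an element of (ker f) J, which lies in K by [kerJ];
    changing the representative adds an element of T K. *)
Lemma quot_scaleE t x : quot_scale (f t) (cls x) = cls (ilmul t x).
Proof.
apply/clsP => /=; set t' := lift_elem _; set x' := zrep _.
have -> : t' * ideal_val x' - t * ideal_val x
    = (t' - t) * ideal_val x' + t * (ideal_val x' - ideal_val x).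
  by rewrite mulrBl mulrBr addrA subrK.
apply: (subgroupD (ideal_subgroup K)).
  by apply: kerJ; [rewrite rmorphB lift_elemK subrr | exact: ideal_valP].
by apply/ideal_mull/clsP; rewrite zrepK.
Qed.

Fact quot_scaleA a b x : quot_scale a (quot_scale b x) = quot_scale (a * b) x.
Proof.
rewrite -[a]lift_elemK -[b]lift_elemK -[x]zrepK -rmorphM !quot_scaleE.
by rewrite ilmulA.
Qed.

Fact quot_scale1 : left_id 1 quot_scale.
Proof. by move=> x; rewrite -(rmorph1 f) -[x]zrepK quot_scaleE ilmul1. Qed.

Fact quot_scaleDr : right_distributive quot_scale +%R.
Proof.
move=> a x y; rewrite -[a]lift_elemK -[x]zrepK -[y]zrepK -raddfD !quot_scaleE.
by rewrite ilmulDr raddfD.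
Qed.

Fact quot_scaleDl x : {morph quot_scale^~ x : a b / a + b}.
Proof.
move=> a b; rewrite -[a]lift_elemK -[b]lift_elemK -[x]zrepK -raddfD.
by rewrite !quot_scaleE ilmulDl raddfD.
Qed.

(* J / (J n K), on which A acts because ker f annihilates it. *)
Definition quot_mod : lmodType A :=
  HB.pack Q (GRing.Zmodule_isLmodule.Build A Q
    quot_scaleA quot_scale1 quot_scaleDr quot_scaleDl).

Lemma quot_modZ t x : f t *: (cls x : quot_mod) = cls (ilmul t x).
Proof. exact: quot_scaleE. Qed.

Hypothesis K_ker : forall x, ideal_set K x -> f x = 0.

Definition from_quot (x : quot_mod) : ideal_type image_ideal :=
  to_image (zrep (x : Q)).

Lemma from_quotE x : from_quot (cls x) = to_image x.
Proof.
apply/subr0_eq; rewrite -to_imageB; apply: val_inj; apply: K_ker.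
by have /asboolP := zrepB sub_pred x.
Qed.

Fact from_quot_linear : linear from_quot.
Proof.
move=> a x y; rewrite -[a]lift_elemK -[x]zrepK -[y]zrepK.
rewrite quot_modZ -[X in from_quot X](raddfD cls) !from_quotE.
by rewrite (zmodmorD to_imageB) to_imageZ.
Qed.

Hypothesis A_hereditary : hereditary A.
Hypothesis Jker :
  forall x y, ideal_set J x -> f y = 0 -> ideal_set K (x * y).
Hypothesis ker_J2 :
  [set x | f x = 0] `<=` mulset (ideal_set J) (ideal_set J).

Lemma hereditary_ker_sub : [set x | f x = 0] `<=` ideal_set K.
Proof.
pose q : {linear quot_mod -> ideal_type image_ideal} :=
  HB.pack from_quot (GRing.isLinear.Build _ _ _ _ _ from_quot_linear).
have q_surj : surjective q.
  move=> [y yI]; have [x Jx xy] := asboolW yI.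
  by exists (cls (ielt Jx)); rewrite [LHS]from_quotE; apply: val_inj.
(* Lifting the identity of f(J) through [q] gives the section [h]; [e] is the associated
   retraction. *)
have [h hK] := hereditary_ideal A_hereditary idfun q_surj.
pose e (x : ideal_type J) : quot_mod := (cls x : quot_mod) - h (to_image x).
have eB : zmod_morphism e.
  have clsB : zmod_morphism (cls : ideal_type J -> quot_mod) := raddfB cls.
  move=> x y; rewrite /e to_imageB [h _]raddfB clsB !opprD !opprK.
  exact: addrACA.
have eZ t x : e (ilmul t x) = f t *: e x.
  by rewrite /e to_imageZ linearZ scalerBr quot_modZ.
have eI x : f (ideal_val (zrep (e x : Q))) = 0.
  have qe0 : q (e x) = 0.
    apply: (etrans (raddfB q _ _)); apply/eqP; rewrite subr_eq0; apply/eqP.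
    by apply: (etrans (from_quotE x)); rewrite [RHS]hK.
  by move: qe0 => /(congr1 (fun y => ideal_val y)).
(* Membership in J is bundled into the property because [e] is defined only on the subtype of J. *)
have J2 : mulset (ideal_set J) (ideal_set J) `<=`
    [set x | exists Jx : ideal_set J x, e (ielt Jx) = 0].
  apply: gspan_min => [|_ [x [y [Jx Jy ->]]]].
    split=> [|x y [Jx ex] [Jy ey]].
      exists (ideal_subgroup J).1; rewrite -(zmodmor0 eB); congr e.
      exact: val_inj.
    exists ((ideal_subgroup J).2 _ _ Jx Jy).
    by rewrite -[RHS](subrr 0) -{1}ex -ey -eB; congr e; exact: val_inj.
  exists (ideal_mull x Jy).
  have -> : ielt (ideal_mull x Jy) = ilmul x (ielt Jy) by exact: val_inj.
  (* By [eI] the value of [e] is the class of some z in ker f, and multiplying by x in J sends z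
     into J (ker f), hence into K. *)
  rewrite eZ -[e _](zrepK (W := sub_pred)) quot_modZ.
  rewrite -[0 in RHS](raddf0 cls); apply/clsP; rewrite subr0.
  by apply: Jker => //; exact: eI.
(* On ker f the section term vanishes, so [e] is the class map and its vanishing says that x is in
   K. *)
move=> x fx; have [Jx] := J2 _ (ker_J2 fx).
rewrite /e; have -> : to_image (ielt Jx) = 0 by apply: val_inj.
by rewrite raddf0 subr0 -[0 in RHS](raddf0 cls) => /clsP; rewrite subr0.
Qed.

End Quotient.

(** * The degree filtration of the tensor algebra *)

Section Degree.
Variables (k : fieldType) (S : algType k) (M : bimod S).
Local Notation T := (tensor_algebra M).

Definition degree_ge (n : nat) : set T :=
  [set x | forall i, (i < n)%N -> (x : dsum (tpowz M)) i = 0].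

Lemma degree_ge_subgroup n : subgroup (degree_ge n).
Proof.
split=> // x y x0 y0 i lt_in.
by rewrite [LHS](dcoefB (V := tpowz M)) x0 // y0 // subr0.
Qed.

Lemma degree_ge_inj n i (z : tpow M i) : (n <= i)%N -> degree_ge n (tinj z).
Proof.
move=> le_ni j lt_jn; apply: (dinj_out (V := tpowz M)).
by rewrite gtn_eqF // (leq_trans lt_jn).
Qed.

(** Reduces additive statements to homogeneous elements, the only ones on which the operations of T
    have explicit formulas. *)
Lemma degree_ge_ind n (W : set T) : subgroup W ->
  (forall i (z : tpow M i), (n <= i)%N -> W (tinj z)) -> degree_ge n `<=` W.
Proof.
move=> hW Wz x xn; rewrite [x](@dsum_sum _ (tpowz M)).
apply: (subgroup_sum _ hW) => i.
have [le_ni|lt_in] := leqP n i; first exact: (Wz i).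
by rewrite xn // raddf0; exact: hW.1.
Qed.

Lemma degree_ge_scale s n x : degree_ge n x -> degree_ge n (ta_scale s x).
Proof.
apply: (degree_ge_ind (W := ta_scale s @^-1` degree_ge n)).
  exact: preim_subgroup (ta_scaleB s) (degree_ge_subgroup n).
by move=> i z le_ni; rewrite /preimage /= ta_scale_inj; exact: degree_ge_inj.
Qed.

Lemma degree_ge_shift m n x : degree_ge n x -> degree_ge n.+1 (ta_shift m x).
Proof.
apply: (degree_ge_ind (W := ta_shift m @^-1` degree_ge n.+1)).
  exact: preim_subgroup (ta_shiftB m) (degree_ge_subgroup _).
by move=> i z le_ni; rewrite /preimage /= ta_shift_inj; exact: degree_ge_inj.
Qed.

(** A pure tensor of degree i acts by i successive shifts, each raising the degree by one, and a
    final scaling that preserves it. *)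
Lemma degree_ge_act i (z : tpow M i) n x :
  degree_ge n x -> degree_ge (i + n) (ta_act z x).
Proof.
elim: i z => [|i IHi] z xn; first exact: degree_ge_scale.
have [W0 WB] := preim_subgroup (ta_actBl (n := i.+1) x)
                  (degree_ge_subgroup (i.+1 + n)).
move: z; apply: tensor_ind => // m y.
by rewrite (ta_act_over m y); exact/degree_ge_shift/IHi.
Qed.

Lemma degree_geM a b x y :
  degree_ge a x -> degree_ge b y -> degree_ge (a + b) (x * y).
Proof.
move=> xa yb.
apply: (degree_ge_ind (W := ( *%R^~ y) @^-1` degree_ge (a + b))) xa.
  exact: preim_subgroup (ta_mulBl y) (degree_ge_subgroup (a + b)).
move=> i z le_ai j lt_j; rewrite [_ * _]ta_mul_inj; apply: degree_ge_act yb _ _.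
by rewrite (leq_trans lt_j) // leq_add2r.
Qed.

Lemma degree_ge_mull n a x : degree_ge n x -> degree_ge n (a * x).
Proof. exact: (@degree_geM 0). Qed.

Lemma degree_ge_mulr n a x : degree_ge n x -> degree_ge n (x * a).
Proof. by move=> xn; rewrite -[n]addn0; exact: degree_geM. Qed.

Definition degree_ideal (n : nat) : ideal T :=
  Ideal (degree_ge_subgroup n) (@degree_ge_mull n) (@degree_ge_mulr n).

Lemma path_ideal_degree : @path_ideal k S M = degree_ge 1.
Proof.
apply/seteqP; split=> x; first by move=> /path_idealE x0 [].
by move=> x1; apply/path_idealE; exact: x1.
Qed.

End Degree.

(** * Induction on the degree of the kernel *)

Theorem theorem6p5 (k : fieldType) (A : algType k)
    (A_artinian : left_artinian A) (A_hereditary : hereditary A)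
    (A_splits : splits_over_radical A)
    (D : finType) (A_ : D -> ideal (radquot A))
    (A_simple : forall i : D, simple_ideal (A_ i))
    (A_sum : internal_direct_sum A_)
    (Omega : D -> D -> finType) (Omega_quiver : natural_quiver A_ Omega)
    (pi : {lrmorphism path_algebra A_ Omega -> A})
    (pi_surj : surjective pi)
    (s : nat) (s_gt0 : (0 < s)%N)
    (Js_ker : powset (path_J A_ Omega) s `<=` [set x | pi x = 0])
    (ker_J : [set x | pi x = 0] `<=` path_J A_ Omega)
    (ker_J2 : [set x | pi x = 0] `<=` powset (path_J A_ Omega) 2) :
  bijective pi.
Proof.
pose J : ideal (path_algebra A_ Omega) :=
  degree_ideal (arrow_bimod A_ Omega) 1.
have kJ2 : [set x | pi x = 0] `<=` mulset (ideal_set J) (ideal_set J).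
  by move: ker_J2; rewrite /path_J path_ideal_degree.
have piB : zmod_morphism pi := raddfB pi.
have piM x y : pi (x * y) = pi x * pi y := rmorphM pi x y.
have ker_degree n :
    [set x | pi x = 0] `<=` @degree_ge _ _ (arrow_bimod A_ Omega) n.
  elim: n => [|n IHn]; first by move=> x _ i.
  have hK := @degree_ge_subgroup _ _ (arrow_bimod A_ Omega) n.+1.
  (* This is the ideal K of the splitting argument. *)
  pose W := [set x | pi x = 0] `&` @degree_ge _ _ (arrow_bimod A_ Omega) n.+1.
  have W_subgroup : subgroup W.
    split=> [|x y [/= x0 xn] [/= y0 yn]].
      by split; [exact: raddf0 | exact: hK.1].
    by split; [rewrite /= [LHS]piB x0 y0 subrr | exact: hK.2].
  have W_mull a x : W x -> W (a * x).
    move=> [/= x0 xn]; split; last exact: degree_ge_mull.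
    by rewrite /= piM x0 mulr0.
  have W_mulr a x : W x -> W (x * a).
    move=> [/= x0 xn]; split; last exact: degree_ge_mulr.
    by rewrite /= piM x0 mul0r.
  have : [set x | pi x = 0] `<=` ideal_set (Ideal W_subgroup W_mull W_mulr).
    (* For both products of the kernel with J, [IHn] contributes degree n and J contributes degree
       1. *)
    apply: (hereditary_ker_sub (J := J) pi_surj) => //
      [x y x0 Jy|x [] //|x y Jx y0].
    - split; first by rewrite /= piM x0 mul0r.
      by rewrite -addn1; apply: degree_geM Jy; exact: IHn.
    - split; first by rewrite /= piM y0 mulr0.
      by rewrite -add1n; apply: degree_geM Jx _; exact: IHn.
  by move=> sub x /sub [].
have pi_inj : injective pi.
  apply: raddf_inj => x x0; apply: (@dsum_eq _ (tpowz (arrow_bimod A_ Omega))).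
  (* The bound in [degree_ge] is strict, so the component in degree i is killed at level i + 1. *)
  by move=> i; exact: (ker_degree i.+1 x x0).
have [g gK] := choice pi_surj.
by exists g => // x; apply: pi_inj; rewrite gK.
Qed.
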